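(* (In ZFC.) The space $2^{\omega_1}$ contains a countable dense S-separable subspace.
   Context: $2^{\omega_1}$ is the product of $\omega_1$ copies of the two-point discrete space $\{0,1\}$ with the product topology. A space $X$ is S-separable if for every sequence $(Y_n)_{n\in\mathbb{N}}$ of dense subspaces of $X$ there exists a sequence $(F_n)_{n\in\mathbb{N}}$ such that each $F_n$ is a finite subset of $Y_n$ and for each finite collection $\mathcal{F}$ of nonempty open sets of $X$ there exists $n\in\mathbb{N}$ with $U\cap F_n\neq\emptyset$ for all $U\in\mathcal{F}$. *)

(* Defs.v *)
From mathcomp Require Import all_boot all_order all_algebra.
From mathcomp Require Import all_classical all_reals all_analysis.
From mathcomp Require wochoice.

Set Implicit Arguments.
Unset Strict Implicit.
Unset Printing Implicit Defensive.

Local Open Scope classical_set_scope.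

(* [(W, R)] has order type omega_1: the least uncountable ordinal is, up to
   isomorphism, the only uncountable well-order all of whose initial segments
   are countable. [R] is the reflexive order, so these segments are closed. *)
Definition is_omega1 (W : Type) (R : rel W) : Prop :=
  [/\ wochoice.well_order R,
      ~ countable [set: W] &
      forall a : W, countable [set b | R b a]].

(* The product topology; the topology of [bool] is the discrete one. *)
Definition two_power (W : Type) : topologicalType :=
  prod_topology (fun _ : W => (bool : topologicalType)).

Definition S_separable (X : topologicalType) : Prop :=
  forall Y : nat -> set X, (forall n, dense (Y n)) ->
  exists F : nat -> set X,
    (forall n, finite_set (F n) /\ F n `<=` Y n) /\
    forall C : set (set X), finite_set C ->
      (forall U, C U -> open U /\ U !=set0) ->
      exists n, forall U, C U -> U `&` F n !=set0.

Lemma uncountable_set_nat : ~ countable [set: set nat].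
Proof.
move=> /countable_injP[f fi].
pose D : set nat := [set n | exists A : set nat, f A = n /\ ~ A n].
have H : D (f D) <-> ~ D (f D).
  split=> [[A [fA nA]]|nD]; last by exists D.
  have AD : A = D by apply: fi; rewrite ?inE.
  by rewrite AD in nA.
have nD : ~ D (f D) by move=> d; exact: (H.1 d d).
exact: nD (H.2 nD).
Qed.

(* The predicate [is_omega1] is satisfiable. *)
Lemma omega1_exists : exists (W : Type) (R : rel W), is_omega1 R.
Proof.
have [R0 wR] := wochoice.well_ordering_principle (set nat : eqType).
have anti x y : R0 x y -> R0 y x -> x = y.
  move=> xy yx.
  have refl z : R0 z z.
    have [|t [[/eqP-> lbt] _]] := wR (pred1 z); first by exists z; rewrite inE.
    by apply: lbt; rewrite inE.
  have [|t [_ tu]] := wR (pred2 x y); first by exists x; rewrite !inE eqxx.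
  rewrite -(tu x) ?(tu y) //; split; rewrite ?inE ?eqxx ?orbT // => z.
    by rewrite !inE => /orP[] /eqP->.
  by rewrite !inE => /orP[] /eqP->.
pose seg x := [set y | R0 y x].
pose W := {x : set nat | countable (seg x)}.
pose R : rel W := fun a b => R0 (sval a) (sval b).
have svi : injective (fun a : W => sval a).
  by move=> a b ab; apply: eq_sig_hprop ab => z p q; exact: bool_irrelevance.
exists W, R; split.
- move=> A [a aA].
  pose A' : {pred set nat} := fun x => `[< exists2 b, b \in A & sval b = x >].
  have A'P b : b \in A -> sval b \in A' by move=> bA; apply/asboolP; exists b.
  have [|z [[zA' lbz] zu]] := wR A'; first by exists (sval a); exact: A'P.
  have [b bA bz] := asboolP _ zA'.
  exists b; split=> [|c [cA lbc]].
    by split=> // c cA; rewrite /R bz; apply: lbz; exact: A'P.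
  apply: svi; rewrite /= bz; apply: zu; split; first exact: A'P.
  by move=> x /asboolP[e eA <-]; exact: lbc.
- move=> cW; pose S := [set x | countable (seg x)].
  have cS : countable S.
    have -> : S = (fun a : W => sval a) @` [set: W].
      by apply/seteqP; split=> [x Sx|_ [[x Sx] _ <-]] //; exists (exist _ x Sx).
    by apply: sub_countable cW; exact: card_image_le.
  have [ST|/existsNP[x0 Sx0]] := pselect (forall x, S x).
    by apply: uncountable_set_nat; rewrite -(_ : S = setT)//; apply/seteqP; split.
  pose C : {pred set nat} := fun x => `[< ~ S x >].
  have [|z [[/asboolP nSz lbz] _]] := wR C; first by exists x0; exact/asboolP.
  apply: nSz; apply: (@sub_countable _ _ _ (S `|` [set z])); last first.
    by rewrite -bigcup2E; apply: bigcup_countable => // -[|[|i]] _ /=.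
  apply: subset_card_le => y yz.
  have [Sy|nSy] := pselect (S y); first by left.
  by right; apply: anti => //; apply: lbz; exact/asboolP.
- move=> a; have /countable_injP[f fi] := svalP a.
  apply/countable_injP; exists (f \o sval) => b c /set_mem Rb /set_mem Rc /= fbc.
  by apply/svi/fi; rewrite ?inE.
Qed.

(* Main.v *)
Require Import Defs.
From mathcomp Require Import all_boot all_order all_algebra.
From mathcomp Require Import all_classical all_reals all_analysis.
From mathcomp Require Import finmap.

(* Index W by an injective family of reals x_a in 2^omega, and let D be the set
   of traces on W of the clopen subsets of 2^omega.  A set F of such traces
   shatters a finite s in W when every subset of s is the trace on s of a member
   of F.  A subset of D is dense iff it shatters every finite set, so
   S-separability of D asks for finite F_n in Y_n such that every finite s is
   shattered by some F_n.

   Suppose first that no family of functions nat -> nat indexed by the finite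
   sequences in W is dominating (in effect omega_1 < d).  Enumerate D and let
   g s n be the length of the first initial piece of Y_n that shatters s; an h
   not dominated by any g s gives F_n as the piece of length h n.

   Otherwise, a transfinite recursion along a dominating family makes every
   finitely supported real some x_a, and all but countably many x_a sparser
   than any prescribed growth rate.  Hence for every h there is a countable C
   such that any finitely many x_b with b outside C have arbitrarily large common
   gaps [n, h n).  If F_n shatters the set of all x_a supported in [0, n), and
   membership in F_n only depends on the first h n digits, then such a common
   gap lets F_n shatter the x_b as well, as they agree up to h n with their
   truncations at n.  Finite sets meeting C are handled by induction on their
   size. *)

Set Implicit Arguments.
Unset Strict Implicit.
Unset Printing Implicit Defensive.

Local Open Scope classical_set_scope.

(** * Shattering and selection *)

Section Selection.
Variables (W : choiceType) (T : Type) (ev : T -> W -> bool).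
Implicit Types (F Y : set T) (s : seq W).

Definition shatters F s :=
  forall p : W -> bool, exists2 c, F c & {in s, ev c =1 p}.

(** Restricting the tasks to a family [E] allows piecewise proofs; S-separability corresponds to
    [E = setT]. *)
Definition selectable (E : set (seq W)) :=
  forall Y : nat -> set T, (forall n s, shatters (Y n) s) ->
  exists F : nat -> set T,
    (forall n, finite_set (F n) /\ F n `<=` Y n) /\
    forall s, E s -> exists n, shatters (F n) s.

End Selection.

(** * Cylinders: translating density into shattering *)

Section Cylinders.
Variable W : choiceType.

Definition cylinder (s : seq W) (p : W -> bool) : set (two_power W) :=
  [set d : two_power W | {in s, forall e, d e = p e}].

Lemma cylinder_open s p : open (cylinder s p).
Proof.
elim: s => [|a s IHs].
  by rewrite (_ : cylinder [::] p = setT); [exact: openT | apply/seteqP].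
rewrite (_ : cylinder (a :: s) p = (proj a) @^-1` [set p a] `&` cylinder s p).
  apply: openI => //; apply: open_comp; last exact: discrete_open.
  by move=> d _; exact: (@proj_continuous W (fun=> bool)).
apply/seteqP; split=> d /= dp.
  split=> [|e es]; first by apply: dp; exact: mem_head.
  by apply: dp; rewrite in_cons es orbT.
by case: dp => da ds e; rewrite in_cons => /predU1P[->|/ds].
Qed.

Lemma open_cylinder (U : set (two_power W)) d :
  open U -> U d -> exists s, cylinder s d `<=` U.
Proof.
move=> oU Ud; have : nbhs d U by exact: open_nbhs_nbhs.
move=> [P [[Q QfinP <-] [V JV Vd]] QU].
suff [s sV] : exists s, cylinder s d `<=` V.
  by exists s => e es; apply: QU; exists V => //; exact: sV.
have [L Lsub VL] := QfinP _ JV.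
have {}Lsub : forall M, M \in L ->
    exists a : W, forall e : two_power W, e a = d a -> M e.
  move=> M LM; have /set_mem[a _ [N oN NM]] := Lsub _ LM.
  exists a => e ea; rewrite -NM /= ea.
  by have : M d by [rewrite -VL in Vd; exact: Vd]; rewrite -NM.
have [a aP] : exists a : set (two_power W) -> seq W, forall M, M \in L ->
    cylinder (a M) d `<=` M.
  suff /choice[a aP] : forall M, exists s, M \in L ->
      cylinder s d `<=` M by exists a.
  move=> M; have [/Lsub[a aM]|ML] := boolP (M \in L); last by exists [::].
  by exists [:: a] => _ e ed; apply: aM; apply: ed; rewrite inE.
exists (flatten [seq a M | M <- L]) => e ed; rewrite -VL => M ML.
apply: (aP M) => // b bM; apply: ed; apply/flattenP; exists (a M) => //.
exact: map_f.
Qed.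

Variable D : set (two_power W).

(** A pattern on [s] is an open cylinder, and [Dsh] makes its trace on [D] nonempty, so that density
    of [Y] applies. *)
Lemma dense_shatters (Y : set (set_type D)) s :
  (forall s, shatters set_val [set: set_type D] s) ->
  dense Y -> shatters set_val Y s.
Proof.
move=> Dsh dY p.
have [||c [cO Yc]] := dY (set_val @^-1` cylinder s p).
- by have [c _ cp] := Dsh s p; exists c.
- by exists (cylinder s p) => //; exact: cylinder_open.
- by exists c.
Qed.

Lemma selectable_S_separable :
  (forall s, shatters set_val [set: set_type D] s) ->
  selectable (@set_val _ D) setT -> S_separable (set_type D).
Proof.
move=> Dsh sel Y dY.
have [|F [FY FP]] := sel Y; first by move=> n s; exact: dense_shatters.
exists F; split=> // C /finite_seqP[S ->{C}] CO.
(* A single finite [s] supports a cylinder inside each member of the collection; shattering [s] then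
   meets them all at once. *)
have [s sP] : exists s, forall U, U \in S ->
    exists p, set_val @^-1` cylinder s p `<=` U.
  elim: S CO => [|U S IHS] CO; first by exists [::].
  have [|s sP] := IHS; first by move=> V VS; apply: CO; rewrite /= inE VS orbT.
  have [[A oA AU] [d Ud]] : open U /\ U !=set0.
    by apply: CO; rewrite /= mem_head.
  have [|t tA] := @open_cylinder A (set_val d) oA; first by rewrite -AU in Ud.
  exists (t ++ s) => V; rewrite inE => /predU1P[->|/sP[p pV]].
    exists (set_val d) => e ed; rewrite -AU /=; apply: tA => b bt.
    by apply: ed; rewrite mem_cat bt.
  by exists p => e ep; apply: pV => b bs; apply: ep; rewrite mem_cat bs orbT.
have [n nP] := FP s I; exists n => U /sP[p pU].
by have [c Fc cp] := nP p; exists c; split=> //; exact: pU.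
Qed.

Lemma shatters_dense :
  (forall s, shatters set_val [set: set_type D] s) -> dense D.
Proof.
move=> Dsh O [d Od] oO; have [s sO] := open_cylinder oO Od.
have [c _ cd] := Dsh s d; exists (set_val c); split; first exact: sO.
exact: set_valP.
Qed.

End Cylinders.

(** * Closure properties of selectable families *)

Section SelectionTheory.
Variables (W T : choiceType) (ev : T -> W -> bool).
Implicit Types (F Y : set T) (s t : seq W) (E : set (seq W)).

Local Notation shatters := (shatters ev).
Local Notation selectable := (selectable ev).

Lemma shattersS F G s t :
  F `<=` G -> {subset t <= s} -> shatters F s -> shatters G t.
Proof.
move=> FG ts Fs p; have [c Fc cp] := Fs p.
by exists c; [exact: FG | move=> e /ts; exact: cp].
Qed.

Lemma shatters_finite Y s :
  shatters Y s -> exists F, [/\ finite_set F, F `<=` Y & shatters F s].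
Proof.
move=> Ys.
(* Patterns on [s] are coded by tuples of values, so finitely many witnesses suffice. *)
have /choice[c cP] : forall t : (size s).-tuple bool, exists c, Y c /\
    {in s, forall e, ev c e = nth false t (index e s)}.
  move=> t; have [c Yc cp] := Ys (fun e => nth false t (index e s)).
  by exists c.
exists (c @` setT); split.
- by apply: finite_image; exact: finite_finset.
- by move=> _ [t _ <-]; case: (cP t).
- move=> p; pose t := map_tuple p (in_tuple s).
  exists (c t); first by exists t.
  move=> e es; rewrite (cP _).2 //= (nth_map e) ?index_mem //.
  by rewrite nth_index.
Qed.

Lemma selectableS E E' : E `<=` E' -> selectable E' -> selectable E.
Proof.
move=> EE' sE' Y dY; have [F [FY FE]] := sE' Y dY.
by exists F; split=> // s /EE'; exact: FE.
Qed.

Lemma selectable_subseqs s : selectable [set t | {subset t <= s}].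
Proof.
move=> Y dY; have /choice[F FP] := fun n => shatters_finite (dY n s).
exists F; split=> [n|t ts]; first by case: (FP n).
by have [_ _ Fs] := FP 0; exists 0; exact: shattersS ts Fs.
Qed.

(** The pairing [choice.pickle] splits [Y] into disjoint subsequences, one for each index in [J],
    and each [E i] is served along its own. *)
Lemma selectable_countable I (J : set I) (E : I -> set (seq W)) :
  countable J -> (forall i, J i -> selectable (E i)) ->
  selectable (\bigcup_(i in J) E i).
Proof.
move=> /countable_injP[f fI] sE Y dY.
have /choice[G GP] : forall i, exists G : nat -> set T, J i ->
    (forall n, finite_set (G n) /\ G n `<=` Y (choice.pickle (f i, n))) /\
    forall s, E i s -> exists n, shatters (G n) s.
  move=> i; have [Ji|] := pselect (J i); last by exists (fun=> set0).
  have [|G GP] := sE i Ji (fun n => Y (choice.pickle (f i, n))).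
    by move=> n s; exact: dY.
  by exists G.
(* At most one index of [J] has code [m]; positions without an index get the empty set. *)
have GF m j : exists F, (finite_set F /\ F `<=` Y (choice.pickle (m, j))) /\
    forall i, J i -> f i = m -> G i j `<=` F.
  have [[i [Ji <-]]|nJ] := pselect (exists i, J i /\ f i = m).
    exists (G i j); split; first by case: (GP i Ji).
    by move=> k Jk fk; rewrite (fI k i (mem_set Jk) (mem_set Ji) fk).
  exists set0; split; first by split; [exact: finite_set0|exact: sub0set].
  by move=> i Ji fi; case: nJ; exists i.
have {GF} /choice[F FP] : forall n, exists F, (finite_set F /\ F `<=` Y n) /\
    forall i j, J i -> choice.pickle (f i, j) = n -> G i j `<=` F.
  move=> n; case nE : (choice.unpickle n : option (nat * nat)) => [[m j]|];
    last first.
    exists set0; split; first by split; [exact: finite_set0 | exact: sub0set].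
    move=> i j _ /(congr1 (@choice.unpickle (nat * nat)%type)).
    by rewrite choice.pickleK nE.
  have [F [FY FG]] := GF m j.
  have [mjn|mjn] := eqVneq (choice.pickle (m, j)) n.
    exists F; rewrite -mjn; split=> // i k Ji.
    move=> /(pcan_inj choice.pickleK)[fim ->]; exact: FG.
  exists set0; split; first by split; [exact: finite_set0 | exact: sub0set].
  move=> i k _ nik; case/eqP: mjn; rewrite -nik.
  by move: nE; rewrite -nik choice.pickleK => -[-> ->].
exists F; split=> [n|s [i Ji Es]]; first by case: (FP n).
have [j Gs] := (GP i Ji).2 s Es; exists (choice.pickle (f i, j)).
by apply: shattersS Gs => //; exact: (FP _).2.
Qed.

(** The leftover family [E'] may depend on [Y] and on the first selection [F]; the second selection
    is joined to it termwise. *)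
Lemma selectable_split E :
  (forall Y : nat -> set T, (forall n s, shatters (Y n) s) ->
    exists F : nat -> set T, (forall n, finite_set (F n) /\ F n `<=` Y n) /\
    exists2 E', selectable E' &
      forall s, E s -> E' s \/ exists n, shatters (F n) s) ->
  selectable E.
Proof.
move=> split_E Y dY; have [F [FY [E' sE' EE']]] := split_E Y dY.
have [G [GY GE']] := sE' Y dY.
exists (fun n => F n `|` G n); split=> [n|s /EE'[/GE'|] [n Hn]].
- have [[Ff FYn] [Gf GYn]] := (FY n, GY n); split; first by rewrite finite_setU.
  by rewrite subUset.
- by exists n; apply: shattersS Hn => //; exact: subsetUr.
- by exists n; apply: shattersS Hn => //; exact: subsetUl.
Qed.

Lemma finite_set_ubound F (P : T -> nat -> Prop) :
  finite_set F -> (forall c m n, m <= n -> P c m -> P c n) ->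
  (forall c, exists n, P c n) -> exists n, forall c, F c -> P c n.
Proof.
move=> /finite_seqP[S ->] Pmono Pex; elim: S => [|c S [n nP]]; first by exists 0.
have [m cm] := Pex c; exists (maxn m n) => d /=.
rewrite in_cons => /predU1P[->|dS]; first by apply: Pmono cm; exact: leq_maxl.
by apply: Pmono (nP d dS); exact: leq_maxr.
Qed.

Lemma selectable_nondominating :
  countable [set: T] ->
  (forall g : seq W -> nat -> nat, exists h, forall s, exists n, g s n <= h n) ->
  selectable setT.
Proof.
move=> /countable_injP[f fI] nondom Y dY.
pose F n k := [set c | Y n c /\ f c < k].
have /choice[g gP] : forall s, exists g : nat -> nat,
    forall n, shatters (F n (g n)) s.
  move=> s; suff /choice[g gP] : forall n, exists k, shatters (F n k) s.
    by exists g.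
  move=> n; have [G [Gf GY Gs]] := shatters_finite (dY n s).
  have [||k kP] := @finite_set_ubound G (fun c k => f c < k) Gf.
  - by move=> c p q pq /leq_trans; apply.
  - by move=> c; exists (f c).+1.
  - by exists k; apply: shattersS Gs => // c Gc; split; [exact: GY|exact: kP].
have [h hP] := nondom g.
exists (fun n => F n (h n)); split=> [n|s _].
  split; last by move=> c [].
  apply: (@sub_finite_set _ _ (f @^-1` `I_(h n))); first by move=> c [].
  apply: finite_preimage; last exact: finite_II.
  by move=> a b _ _; apply: fI; exact: in_setT.
have [n gn] := hP s; exists n; apply: shattersS (gP s n) => // c [Yc fc].
by split=> //; exact: leq_trans gn.
Qed.

End SelectionTheory.

(** * Selection from gaps in a family of reals *)

Section Reals.
Variables (W T : choiceType) (ev : T -> W -> bool) (x : W -> nat -> bool).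
Hypothesis x_inj : injective x.

Definition agree n (a b : W) := forall i, i < n -> x a i = x b i.

Lemma agree_sep (s : seq W) : exists N, forall n, N <= n ->
  {in s &, forall a b, agree n a b -> a = b}.
Proof using x_inj.
have /choice[m mP] : forall ab : W * W, exists m,
    ab.1 <> ab.2 -> x ab.1 m <> x ab.2 m.
  move=> [a b]; have [->|ab] := pselect (a = b); first by exists 0.
  have /existsNP[m xm] : ~ (forall i, x a i = x b i).
    by move=> xab; apply/ab/x_inj/funext.
  by exists m.
exists (\max_(ab <- [seq (a, b) | a <- s, b <- s]) (m ab).+1).
move=> n nmax a b sa sb.
apply: contraPP => ab agab; apply: (mP (a, b)) => //; apply: agab.
apply: leq_trans nmax.
apply: (@leq_bigmax_seq _ _ xpredT (fun ab => (m ab).+1)) => //.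
exact: allpairs_f.
Qed.

Definition eventually_false (z : nat -> bool) :=
  exists n, forall i, n <= i -> z i = false.

Hypothesis x_fin : forall z, eventually_false z -> exists a, x a = z.

(** There are only [2^n] reals vanishing from [n] on, and [x_fin] gives each of them an index. *)
Lemma truncations n : exists L : seq W, forall a, exists b,
  [/\ b \in L, agree n a b & forall i, n <= i -> x b i = false].
Proof using x_fin.
have /choice[w wP] : forall t : n.-tuple bool, exists a,
    x a = (fun i => nth false t i).
  by move=> t; apply: x_fin; exists n => i ni; rewrite nth_default ?size_tuple.
exists [seq w t | t <- enum {: n.-tuple bool}] => a.
exists (w [tuple x a i | i < n]).
split=> [|i ni|i ni]; first by rewrite map_f // mem_enum.
- by rewrite wP -[i]/(val (Ordinal ni)) nth_mktuple.
- by rewrite wP nth_default // size_tuple.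
Qed.

Hypothesis ev_local : forall c, exists n, forall a b,
  agree n a b -> ev c a = ev c b.

Definition gap_property := forall h : nat -> nat,
  exists2 C : set W, countable C &
  forall B : seq W, {in B, forall b, ~ C b} -> forall N, exists2 n, N <= n &
    {in B, forall b i, n <= i < h n -> x b i = false}.

(** Induction on [k] with [A] arbitrary, since [A] absorbs the elements of [B] that fall in the
    exceptional set [C]. *)
Lemma selectable_bounded (k : nat) (A : seq W) : gap_property ->
  selectable ev [set s | exists2 B, size B = k & {subset s <= A ++ B}].
Proof using x_inj x_fin ev_local.
move=> gap; elim: k A => [|k IHk] A.
  apply: (selectableS _ (selectable_subseqs (ev := ev) A)) => s [B /size0nil ->].
  by rewrite cats0.
apply: selectable_split => Y dY; have /choice[L LP] := truncations.
have /choice[F FP] := fun n => shatters_finite (dY n (A ++ L n)).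
exists F; split=> [n|]; first by case: (FP n).
(* [h n] bounds the digits on which the finitely many members of [F n] depend; gaps are requested
   for this [h]. *)
have /choice[h hP] : forall n, exists h, forall c, F n c ->
    forall a b, agree h a b -> ev c a = ev c b.
  move=> n; have [Ff _ _] := FP n.
  apply: (@finite_set_ubound _ (F n)
    (fun c h => forall a b, agree h a b -> ev c a = ev c b)) => //.
  move=> c p q pq cp a b ab.
  by apply: cp => i ip; apply: ab; exact: leq_trans pq.
have [C cC CP] := gap h.
exists (\bigcup_(b in C)
    [set s | exists2 B, size B = k & {subset s <= (b :: A) ++ B}]).
  by apply: selectable_countable => // b _; exact: IHk.
move=> s [B sB sAB].
have [[b [bB Cb]]|nC] := pselect (exists b, b \in B /\ C b).
  left; exists b => //; exists (rem b B); first by rewrite size_rem // sB.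
  move=> e /sAB; rewrite /= in_cons !mem_cat => /orP[->|]; first by rewrite orbT.
  by rewrite (perm_mem (perm_to_rem bB)) in_cons => /orP[->|->]; rewrite ?orbT.
right; have [N NP] := agree_sep (A ++ B).
have [n Nn nB] := CP B (fun b bB Cb => nC (ex_intro _ b (conj bB Cb))) N.
exists n; have [_ _ Fsh] := FP n.
apply: shattersS sAB _; first exact: subset_refl.
have {}NP := NP n Nn.
(* [phi] fixes [A] and truncates the rest of [B] at [n]. The gap from [n] to [h n] makes an element
   and its truncation indistinguishable for [F n]. *)
have /choice[phi phiP] : forall e, exists e', e \in A ++ B ->
    [/\ e' \in A ++ L n, agree n e e' & agree (h n) e e'].
  move=> e; have [eA|eA] := boolP (e \in A).
    by exists e => _; split=> //; rewrite mem_cat eA.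
  have [e' [eL ee' e'0]] := LP n e; exists e'.
  rewrite mem_cat (negPf eA) => eB; split=> [|//|i ih].
    by rewrite mem_cat eL orbT.
  have [ni|ni] := leqP n i; last exact: ee'.
  by rewrite e'0 // (nB e eB) // ni.
move=> p.
(* As n separates A ++ B, the pattern p factors through truncation at n. *)
pose p' w := `[< exists e, [/\ e \in A ++ B, agree n e w & p e] >].
have [c Fc cp] := Fsh p'; exists c => // e eAB.
have [phiL nphi hphi] := phiP e eAB.
rewrite (hP n c Fc _ _ hphi) cp //.
apply/asboolP/idP => [[e' [e'AB e'e pe']]|pe]; last by exists e.
by rewrite (NP e e') // => i ni; rewrite nphi // e'e.
Qed.

Lemma selectable_gap : gap_property -> selectable ev setT.
Proof using x_inj x_fin ev_local.
move=> gap; apply: (@selectableS _ _ _ _ (\bigcup_(k in [set: nat])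
    [set s | exists2 B, size B = k & {subset s <= [::] ++ B}])).
  by move=> s _; exists (size s) => //; exists s.
by apply: selectable_countable => // k _; exact: selectable_bounded.
Qed.

End Reals.

(** * Sparse reals: at most [j] ones below [g j] for all large [j] *)

Definition sparse (g : nat -> nat) (z : nat -> bool) :=
  exists N, forall j, N <= j -> exists2 L : seq nat, size L <= j &
    forall i, i < g j -> z i -> i \in L.

Lemma eventually_false_sparse g z : eventually_false z -> sparse g z.
Proof.
move=> [n zn]; exists n => j nj; exists (iota 0 n); first by rewrite size_iota.
move=> i _ zi; rewrite mem_iota /= add0n; apply: contraTT zi.
by rewrite -leqNgt => /zn->.
Qed.

Lemma sparse_le g g' z : (exists N, forall n, N <= n -> g' n <= g n) ->
  sparse g z -> sparse g' z.
Proof.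
move=> [M gM] [N zN]; exists (maxn M N) => j; rewrite geq_max => /andP[Mj Nj].
have [L Lj LP] := zN j Nj; exists L => // i ig; apply: LP.
exact: leq_trans (gM j Mj).
Qed.

(** Otherwise a point of [L] chosen in each of the [K] disjoint intervals would give [K] distinct
    elements of [L]. *)
Lemma interval_pigeonhole (v : nat -> nat) (L : seq nat) K :
  {homo v : m n / m <= n} -> size L < K ->
  exists2 k, k < K & forall i, i \in L -> v k <= i < v k.+1 -> False.
Proof.
move=> v_mono LK; apply: contrapT => nk.
have /choice[l lP] : forall k, exists i, k < K -> i \in L /\ v k <= i < v k.+1.
  move=> k; have [kK|] := boolP (k < K); last by exists 0.
  apply: contrapT => ni; apply: nk; exists k => // i iL vi; apply: ni.
  by exists i.
suff : K <= size L by rewrite leqNgt LK.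
rewrite -[leqLHS](size_iota 0) -(size_map l); apply: uniq_leq_size.
  have l_mono m n : n < K -> m < n -> l m < l n.
    move=> nK mn; have [_ /andP[_ lm]] := lP m (ltn_trans mn nK).
    have [_ /andP[ln _]] := lP n nK.
    by apply: leq_trans lm (leq_trans _ ln); exact: v_mono.
  rewrite map_inj_in_uniq ?iota_uniq// => m n; rewrite !mem_iota /= !add0n.
  move=> mK nK lmn; have [mn|nm|//] := ltngtP m n.
    by have := l_mono _ _ nK mn; rewrite lmn ltnn.
  by have := l_mono _ _ mK nm; rewrite lmn ltnn.
by move=> _ /mapP[k + ->]; rewrite mem_iota /= add0n => /lP[].
Qed.

Lemma sparse_gap (W : eqType) (x : W -> nat -> bool) (h : nat -> nat) :
  exists g, forall B : seq W, {in B, forall b, sparse g (x b)} ->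
  forall N, exists2 n, N <= n &
    {in B, forall b i, n <= i < h n -> x b i = false}.
Proof.
(* The intervals [u^k j, u^k.+1 j) with k <= j * j lie below g j and outnumber
   the at most size B * j elements of the x b there. *)
pose u m := maxn (h m) m.+1.
have u_gt m : m < u m by rewrite leq_max leqnn orbT.
pose g j := iter (j * j).+1 u j.
exists g => B Bg N.
have [M MP] : exists M, forall b, b \in B -> forall j, M <= j ->
    exists2 L : seq nat, size L <= j & forall i, i < g j -> x b i -> i \in L.
  elim: B Bg => [|b B IHB] Bg; first by exists 0.
  have [|M MP] := IHB; first by move=> c cB; apply: Bg; rewrite in_cons cB orbT.
  have [M' M'P] := Bg b (mem_head _ _); exists (maxn M' M) => c.
  rewrite in_cons => /predU1P[->|cB] j; rewrite geq_max => /andP[? ?].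
    exact: M'P.
  exact: MP.
pose j := maxn (maxn M N) (size B).
have [Mj Nj Bj] : [/\ M <= j, N <= j & size B <= j].
  by rewrite /j !leq_max !leqnn !orbT.
have [L LB LP] : exists2 L : seq nat, size L <= size B * j &
    forall b, b \in B -> forall i, i < g j -> x b i -> i \in L.
  have {MP} : forall b, b \in B -> exists2 L : seq nat, size L <= j &
    forall i, i < g j -> x b i -> i \in L by move=> b /MP; exact.
  elim: (B) => [|b B' IHB] BL; first by exists [::].
  have [|L LB LP] := IHB.
    by move=> c cB; apply: BL; rewrite in_cons cB orbT.
  have [L' Lj L'P] := BL b (mem_head _ _); exists (L' ++ L) => [|c].
    by rewrite size_cat mulSn leq_add.
  rewrite in_cons => /predU1P[->|cB] i ig xi; rewrite mem_cat.
    by rewrite L'P.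
  by rewrite (LP c) ?orbT.
have v_mono : {homo (fun k => iter k u j) : m n / m <= n}.
  by apply: homo_leq => // [m n p|k]; [exact: leq_trans|rewrite iterS ltnW].
have [|k kj kL] := @interval_pigeonhole _ L (j * j).+1 v_mono.
  by rewrite ltnS (leq_trans LB)// leq_mul2r Bj orbT.
exists (iter k u j); first by apply: leq_trans Nj _; exact: (v_mono 0).
move=> b bB i /andP[ki ih]; apply/negbTE/negP => xi.
have iu : i < iter k.+1 u j by rewrite iterS (leq_trans ih) ?leq_maxl.
apply: (kL i); last by rewrite ki.
by apply: LP bB _ _ xi; apply: leq_trans iu _; exact: v_mono.
Qed.

(** Diagonalisation: [y] is supported on the range of a fast strictly increasing [f], and its digit
    at [f l] is opposite to that of [z l]. *)
Lemma sparse_avoid (g : nat -> nat -> nat) (z : nat -> nat -> bool) :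
  exists y, (forall l, sparse (g l) y) /\ forall l, y <> z l.
Proof.
pose G i := \sum_(l < i.+1) g l i.
(* The successor makes [f] strictly increasing; the sums give [g l j <= f j] once [l <= j]. *)
pose f j := \sum_(i < j.+1) (G i).+1.
have fS j : f j.+1 = f j + (G j.+1).+1 by rewrite /f big_ord_recr.
have f_mono : {mono f : m n / m <= n}.
  apply: leq_mono; apply: homo_ltn => [m n p|j]; first exact: ltn_trans.
  by rewrite fS addnS ltnS leq_addr.
have gf l j : l <= j -> g l j <= f j.
  move=> lj; apply: (@leq_trans (G j)).
    by rewrite /G (bigD1 (Ordinal (lj : l < j.+1))) //= leq_addr.
  by rewrite /f big_ord_recr /= (leq_trans (leqnSn _))// leq_addl.
pose y n := `[< exists2 l, n = f l & z l n = false >].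
exists y; split=> l.
  exists l => j lj; exists (map f (iota 0 j)).
    by rewrite size_map size_iota.
  move=> i ig /asboolP[k ik _]; rewrite ik map_f // mem_iota /= add0n.
  rewrite -(leqW_mono f_mono) -ik; exact: leq_trans ig (gf l j lj).
move=> /(congr1 (@^~ (f l))); have : y (f l) = ~~ z l (f l).
  apply/asboolP/idP => [[k fkl]|].
    have -> : k = l by apply/esym/(incn_inj f_mono).
    by move=> ->.
  by move=> /negbTE zl; exists l.
by move=> ->; case: (z l _).
Qed.

(** * Countability and well-founded recursion *)

Lemma countable_enum T (t0 : T) (A : set T) :
  countable A -> exists e : nat -> T, forall a, A a -> exists n, e n = a.
Proof.
move=> /countable_injP[f fI].
have /choice[e eP] : forall n, exists a, forall b, A b -> f b = n -> b = a.
  move=> n; have [[a [Aa <-]]|nA] := pselect (exists a, A a /\ f a = n).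
    by exists a => b Ab; apply: fI; apply: mem_set.
  by exists t0 => b Ab fb; case: nA; exists b.
by exists e => a Aa; exists (f a); rewrite -(eP (f a) a).
Qed.

Lemma countable_seqs (W : choiceType) (A : set W) :
  countable A -> countable [set t : seq W | {in t, forall a, A a}].
Proof.
move=> /countable_injP[f fI]; apply/countable_injP.
exists (fun t => choice.pickle (map f t)) => s t /set_mem sA /set_mem tA.
move=> /(pcan_inj choice.pickleK).
elim: s t sA tA => [|a s IHs] [|b t] //= sA tA [fab st].
have -> : a = b.
  by apply: fI => //; apply/mem_set; [exact/sA/mem_head|exact/tA/mem_head].
congr (_ :: _); apply: IHs st => e ein.
  by apply: sA; rewrite in_cons ein orbT.
by apply: tA; rewrite in_cons ein orbT.
Qed.

(** The stage choices [phi] are fixed in advance. Recursion feeds them the values below [a] padded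
    with [t0], which [Pext] renders harmless. *)
Lemma wf_choice (W T : Type) (lt : W -> W -> Prop)
    (P : W -> (W -> T) -> T -> Prop) (t0 : T) : well_founded lt ->
  (forall a f f' y, (forall b, lt b a -> f b = f' b) -> P a f y -> P a f' y) ->
  (forall a f, exists y, P a f y) ->
  exists f, forall a, P a f (f a).
Proof.
move=> wf Pext Pex.
have /choice[phi phiP] : forall af : W * (W -> T), exists y, P af.1 af.2 y.
  by move=> [a f]; exact: Pex.
pose below a (r : forall b, lt b a -> T) b :=
  if pselect (lt b a) is left ba then r b ba else t0.
pose f := Fix wf (fun=> T) (fun a r => phi (a, below a r)).
have fE a : f a = phi (a, below a (fun b _ => f b)).
  rewrite /f Fix_eq // => b r r' rr'; congr (phi (_, _)).
  by apply/funext => c; rewrite /below; case: pselect.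
exists f => a; rewrite fE; apply: Pext (phiP (a, _)) => b ba.
by rewrite /= /below; case: pselect.
Qed.

Lemma well_order_total (W : eqType) (R : rel W) : wochoice.well_order R ->
  total R /\ antisymmetric R.
Proof.
move=> wR.
have R_wo : wochoice.wo_chain R xpredT by move=> A _; exact: wR.
split; first by move=> a b; exact: (wochoice.wo_chainW R_wo).
by move=> a b; exact: (wochoice.wo_chain_antisymmetric R_wo).
Qed.

Lemma well_order_wf (W : eqType) (R : rel W) : wochoice.well_order R ->
  well_founded (fun b a => R b a && (b != a)).
Proof.
move=> wR a0; apply: contrapT => nAcc; have [_ R_anti] := well_order_total wR.
pose A : {pred W} := fun a => `[< ~ Acc (fun b a => R b a && (b != a)) a >].
have [|a [[/asboolP nA lbA] _]] := wR A; first by exists a0; exact/asboolP.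
apply: nA; constructor => b /andP[ba bna]; apply: contrapT => nb.
by case/eqP: bna; apply: R_anti; rewrite ba lbA //; exact/asboolP.
Qed.

Lemma uncountable_inj_nat (W : choiceType) :
  ~ countable [set: W] -> exists f : nat -> W, injective f.
Proof.
move=> ncW; have [f] : $|{inj [set: nat] >-> W}|.
  elim/choicePpointed: W ncW => W ncW.
    by case: ncW; rewrite emptyE; exact: countable0.
  apply/pcard_leTP/infiniteP => /finite_set_countable; exact: ncW.
by exists f => m n; apply: (@inj _ _ [set: nat] f); rewrite in_setT.
Qed.

(** Below any [a] there are countably many indices and finite sequences, so each stage of the
    recursion is an instance of [sparse_avoid]. *)
Lemma omega1_reals (W : choiceType) (R : rel W) (g : seq W -> nat -> nat) :
  is_omega1 R -> exists x : W -> nat -> bool,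
    [/\ injective x, forall z, eventually_false z -> exists a, x a = z &
        forall t a, {in t, forall e, R e a} -> sparse (g t) (x a)].
Proof.
move=> [wR ncW cR]; have [R_total R_anti] := well_order_total wR.
pose Q : set (nat -> bool) := [set z | eventually_false z].
have cQ : countable Q.
  apply: (@sub_countable _ _ _ (range (fun t : seq bool => nth false t))).
    apply: subset_card_le => z [n zn]; exists (mkseq z n) => //.
    apply/funext => i; have [ni|ni] := leqP n i; last by rewrite nth_mkseq.
    by rewrite nth_default ?size_mkseq // zn.
  exact: sub_countable (card_image_le _ _) _.
(* [q] reserves an index for every eventually false real. *)
have [q qI] : exists q : (nat -> bool) -> W, {in Q &, injective q}.
  have [f fI] := uncountable_inj_nat ncW.
  have /countable_injP[c cI] := cQ.
  by exists (f \o c) => y z Qy Qz /fI; exact: cI.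
pose P a (f : W -> nat -> bool) y := [/\ ~ Q y,
    forall t, {in t, forall e, R e a} -> sparse (g t) y &
    forall b, R b a && (b != a) -> y <> f b].
have [|a f|s sP] := @wf_choice W (nat -> bool) _ P xpred0 (well_order_wf wR).
- move=> a f f' y ff' [nQy ysp yf]; split=> // b ba.
  by rewrite -ff' //; exact: yf.
- have [e eP] := countable_enum [::] (countable_seqs (cR a)).
  have [d dP] : exists d : nat -> nat -> bool, forall z,
      Q z \/ (exists2 b, R b a & z = f b) -> exists n, d n = z.
    apply: (countable_enum xpred0
      (A := [set z | Q z \/ exists2 b, R b a & z = f b])).
    rewrite (_ : mkset _ = Q `|` f @` [set b | R b a]).
      rewrite -bigcup2E; apply: bigcup_countable => // -[|[|i]] _ //=.
      exact: sub_countable (card_image_le _ _) (cR a).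
    apply/seteqP; split=> z [Qz|[b Rb zb]]; first [by left|by right; exists b].
  have [y [ysp yd]] := sparse_avoid (g \o e) d; exists y; split.
  + by move=> Qy; have [n dn] := dP y (or_introl Qy); exact: (yd n).
  + by move=> t /eP[n <-]; exact: ysp.
  + move=> b /andP[ba _] yf.
    have [n dn] := dP y (or_intror (ex_intro2 _ _ b ba yf)).
    exact: (yd n).
(* The recursive family [s] is overwritten on the reserved indices. As [s] avoids [Q], injectivity
   survives. *)
have /choice[x xP] : forall a, exists z, (Q z /\ q z = a) \/
    ((forall z, Q z -> q z <> a) /\ z = s a).
  move=> a; have [[z [Qz qz]]|nq] := pselect (exists z, Q z /\ q z = a).
    by exists z; left.
  by exists (s a); right; split=> // z Qz qz; apply: nq; exists z.
exists x; split.
- have s_inj a b : s a = s b -> a = b.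
    move=> sab; apply: contrapT => /eqP nab.
    have [_ _ sa] := sP a; have [_ _ sb] := sP b.
    have /orP[ab|ba] := R_total a b; first by apply: (sb a); rewrite ?ab.
    by apply: (sa b); rewrite ?ba 1?eq_sym.
  move=> a b xab; have [[Qa qa]|[na xa]] := xP a;
    have [[Qb qb]|[nb xb]] := xP b.
  + by rewrite -qa -qb xab.
  + by case: (sP b) => /(_ _)[]; rewrite -xb -xab.
  + by case: (sP a) => /(_ _)[]; rewrite -xa xab.
  + by apply: s_inj; rewrite -xa -xb.
- move=> z Qz; exists (q z); have [[Qx qx]|[nq _]] := xP (q z).
    by apply: qI => //; exact: mem_set.
  by case: (nq z).
- move=> t a ta; have [[Qx _]|[_ ->]] := xP a.
    exact: eventually_false_sparse.
  by case: (sP a) => _ + _; exact.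
Qed.

(** * Traces of clopen sets *)

Section Traces.
Variables (W : choiceType) (x : W -> nat -> bool).

(** [u] codes the clopen subset of the Cantor space formed by the reals whose first [u.1] digits
    spell a word of [u.2]. *)
Definition clopen_trace (u : nat * seq (seq bool)) : two_power W :=
  fun a => mkseq (x a) u.1 \in u.2.

Definition clopen_traces : set (two_power W) := range clopen_trace.

Lemma clopen_traces_countable : countable clopen_traces.
Proof. exact: sub_countable (card_image_le _ _) _. Qed.

Lemma clopen_traces_local (c : set_type clopen_traces) :
  exists n, forall a b, agree x n a b -> set_val c a = set_val c b.
Proof.
case: c => c cD; have [[n S] _ cE] := set_mem cD; exists n => a b ab.
rewrite set_valE /= -cE /clopen_trace /=; congr (_ \in S).
by apply/eq_in_map => i; rewrite mem_iota /= add0n; exact: ab.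
Qed.

Lemma clopen_traces_shatter (s : seq W) : injective x ->
  shatters set_val [set: set_type clopen_traces] s.
Proof.
move=> x_inj p; have [n nP] := agree_sep x_inj s.
(* At a depth [n] separating [s], the prefixes of the elements satisfying [p] are shared by no other
   element of [s]. *)
pose u := (n, [seq mkseq (x a) n | a <- s & p a]).
have uD : clopen_trace u \in clopen_traces by apply/mem_set; exists u.
exists (SigSub uD) => // e es.
rewrite set_valE /= /clopen_trace /=; apply/mapP/idP => [[a]|pe]; last first.
  by exists e => //; rewrite mem_filter pe.
rewrite mem_filter => /andP[pa sa] ea.
rewrite (nP n (leqnn n) e a es sa) // => i ni.
by rewrite -(nth_mkseq false (x e) ni) ea nth_mkseq.
Qed.

End Traces.

(** * The two cases and the conclusion *)

Lemma omega1_dense_S_separable (W : choiceType) (R : rel W) (hW : is_omega1 R) :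
  exists D : set (two_power W),
    [/\ countable D, dense D & S_separable (set_type D)].
Proof.
suff [x [x_inj x_sel]] : exists x : W -> nat -> bool, injective x /\
    selectable (@set_val _ (clopen_traces x)) setT.
  exists (clopen_traces x); split; first exact: clopen_traces_countable.
    by apply: shatters_dense => s; exact: clopen_traces_shatter.
  by apply: selectable_S_separable => // s; exact: clopen_traces_shatter.
have [[g g_dom]|nondom] := pselect (exists g : seq W -> nat -> nat,
    forall h, exists t, exists N, forall n, N <= n -> h n <= g t n).
  have [x [x_inj x_fin x_sp]] := omega1_reals g hW.
  exists x; split=> //; apply: (selectable_gap x_inj x_fin) => [|h].
    exact: clopen_traces_local.
  have [g' g'P] := sparse_gap x h; have [t tP] := g_dom g'.
  have [wR _ cR] := hW; have [R_total _] := well_order_total wR.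
  (* An index outside these countable segments lies above every entry of [t], so its real is sparse
     for [g t], hence for [g']. *)
  exists (\bigcup_(e in [set` t]) [set b | R b e]).
    apply: bigcup_countable => [|e _]; last exact: cR.
    by apply/finite_set_countable/finite_seqP; exists t.
  move=> B BC; apply: g'P => b bB; apply: sparse_le tP _; apply: x_sp => e et.
  have /orP[//|be] := R_total e b.
  by case: (BC b bB); exists e.
have [x [x_inj _ _]] := omega1_reals (fun _ _ => 0) hW.
exists x; split=> //; apply: selectable_nondominating => [|g].
  have /countable_injP[f fI] := clopen_traces_countable x.
  apply/countable_injP; exists (f \o set_val) => c d _ _ /= fcd.
  by apply: val_inj; apply: fI fcd; apply/mem_set/set_valP.
(* If every [h] were strictly below some [g t] everywhere, [g] would be dominating with threshold
   [0]. *)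
apply: contrapT => nh; apply: nondom; exists g => h.
apply: contrapT => nt; apply: nh; exists h => t; apply: contrapT => nn.
apply: nt; exists t; exists 0 => n _; rewrite leqNgt; apply/negP => hn.
by apply: nn; exists n; exact: ltnW.
Qed.

Theorem corollary3p45 (W : Type) (R : rel W) (hW : is_omega1 R) :
  exists D : set (two_power W),
    [/\ countable D, dense D & S_separable (set_type D)].
(* [{classic W}] equips the bare type [W] with a classical choice structure. *)
Proof. exact: (@omega1_dense_S_separable {classic W} R hW). Qed.
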